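(* Suppose all customers have unit utility ($u_k=1$ for all $k\in\mathcal N$) and assume $0\le\theta<\frac\pi2$ and $0\le\theta_{\rm zs}<\frac\pi2$. Then: (1) $\textsc{GreedyAlloc}_{\sf C}$ is an $\alpha$-approximation for $\textsc{sMaxOPF}_{\sf C}$, where $\alpha=\big(\lfloor\sec\theta\cdot\sec\tfrac\theta2\rfloor+1\big)^{-1}$; (2) $\textsc{GreedyAlloc}_{\sf V}$ is an $\alpha$-approximation for $\textsc{sMaxOPF}_{\sf V}$, where $\alpha=\big(\lfloor\eta\cdot\rho\cdot\sec\theta_{\rm zs}\rfloor+1\big)^{-1}$; (3) $\textsc{GreedyAlloc}$ is an $\alpha$-approximation for $\textsc{sMaxOPF}$, where $\alpha=\big(\lfloor\eta\cdot\rho\cdot\sec\theta_{\rm zs}\rfloor+\lfloor\sec\theta\cdot\sec\tfrac\theta2\rfloor+2\big)^{-1}$.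
   Context: Rooted tree $\mathcal G=(\mathcal V,\mathcal E)$ with root $0$; each edge $e$ has impedance $z_e\in\mathbb C$ with $z_e^{\rm R}=\mathrm{Re}(z_e)>0$, $z_e^{\rm I}=\mathrm{Im}(z_e)>0$. Customers $\mathcal N$ ($n=|\mathcal N|$) are attached to non-root nodes; customer $k$ has inelastic demand $s_k\in\mathbb C$ (real/imaginary parts $s_k^{\rm R},s_k^{\rm I}$), utility $u_k$, and decision $x_k\in\{0,1\}$. For an edge $e$, $P_e$ is the set of edges on the path from $e$ (inclusive) to the root; for a customer $k$ at node $j$, $P_k$ is the set of edges on the path from $j$ to the root. Given are nonnegative reals $\hat C_e$ ($e\in\mathcal E$) and a real number $\overline V$. Constraints: (C) $\big|\sum_{k:e\in P_k}s_kx_k\big|\le\hat C_e$ for all $e\in\mathcal E$; (V) $\sum_{k\in\mathcal N}\big(\sum_{e'\in P_k\cap P_e}(z^{\rm R}_{e'}s_k^{\rm R}+z^{\rm I}_{e'}s_k^{\rm I})\big)x_k\le\overline V$ for all $e\in\mathcal E$. $\textsc{sMaxOPF}$ maximizes $\sum_ku_kx_k$ over $x\in\{0,1\}^{\mathcal N}$ subject to (C) and (V); $\textsc{sMaxOPF}_{\sf C}$ uses only (C); $\textsc{sMaxOPF}_{\sf V}$ uses only (V). $\textsc{GreedyAlloc}$ (resp. $\textsc{GreedyAlloc}_{\sf C}$, $\textsc{GreedyAlloc}_{\sf V}$): sort customers so that $|s_1|\le|s_2|\le\cdots$; start with $M=\varnothing$; for each customer $k$ in this order, add $k$ to $M$ if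 setting $x_{k'}=1$ exactly for $k'\in M\cup\{k\}$ satisfies the constraints of $\textsc{sMaxOPF}$ (resp. $\textsc{sMaxOPF}_{\sf C}$, $\textsc{sMaxOPF}_{\sf V}$); output $M$. An $\alpha$-approximation outputs a feasible solution of utility at least $\alpha$ times the optimum. Parameters: $\theta=\max_{k,k'\in\mathcal N}|\arg(s_k)-\arg(s_{k'})|$; $\theta_{\rm zs}=\max_{k\in\mathcal N,e\in P_k}|\arg(s_k)-\arg(z_e)|$; $\eta=\max_{e\in\mathcal E}|P_e|$; $\rho=\max_{\tilde e\in\mathcal E}\max_{e,e'\in P_{\tilde e}}|z_e|/|z_{e'}|$. *)

(* Defs.v *)
From HB Require Import structures.
From mathcomp Require Import all_boot all_order all_algebra.
From mathcomp Require Import complex.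
From mathcomp Require Import boolp reals trigo.

Set Implicit Arguments.
Unset Strict Implicit.
Unset Printing Implicit Defensive.

Import Order.TTheory GRing.Theory Num.Theory.
Local Open Scope ring_scope.

Section ComplexAndTrig.
Variable R : realType.

(* R-valued modulus; the generic `|z| takes values in R[i]. *)
Definition cmod (z : R[i]) : R := ComplexField.Normc.normc z.

(* Principal argument, in ]-pi, pi], with the convention carg 0 = 0. *)
Definition carg (z : R[i]) : R :=
  if z == 0 then 0
  else if 0 <= complex.Im z then acos (complex.Re z / cmod z)
  else - acos (complex.Re z / cmod z).

Definition sec (x : R) : R := (cos x)^-1.

End ComplexAndTrig.

Section Graph.
Variables (V : finType) (E : {set {set V}}).

Definition adj : rel V := fun v w => [set v; w] \in E.

Definition simple_graph : Prop := forall e, e \in E -> #|e| = 2%N.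

Definition connected_graph : Prop := forall v w, connect adj v w.

Definition acyclic : Prop := forall c : seq V, ucycle adj c -> (size c <= 2)%N.

Definition tree : Prop := [/\ simple_graph, connected_graph & acyclic].

Definition edges_on (v : V) (p : seq V) : seq {set V} :=
  pairmap (fun x y => [set x; y]) v p.

Definition simple_path_to (r v : V) (p : seq V) : Prop :=
  [/\ path adj v p, uniq (v :: p) & last v p = r].

(* In a tree the path p below exists and is unique. *)
Definition node_path (r v : V) : {set {set V}} :=
  [set f | `[< exists2 p, simple_path_to r v p & f \in edges_on v p >] ].

(* The path from the edge e (inclusive) to r is the simple path ending at r
   whose first edge is e. *)
Definition edge_path (r : V) (e : {set V}) : {set {set V}} :=
  [set f | `[< exists v w p, [/\ e = [set v; w], simple_path_to r v (w :: p)
                               & f \in edges_on v (w :: p)] >] ].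

End Graph.

Record opf_instance (R : realType) := OpfInstance {
  node : finType;
  edges : {set {set node}};
  root : node;
  treeP : tree edges;
  impedance : {set node} -> R[i];
  impedance_Re_gt0 : forall e, e \in edges -> 0 < complex.Re (impedance e);
  impedance_Im_gt0 : forall e, e \in edges -> 0 < complex.Im (impedance e);
  customer : finType;
  location : customer -> node;
  location_neq_root : forall k, location k != root;
  demand : customer -> R[i];
  utility : customer -> R;
  capacity : {set node} -> R;
  capacity_ge0 : forall e, e \in edges -> 0 <= capacity e;
  Vbar : R
}.

Section Problem.
Variables (R : realType) (I : opf_instance R).

Local Notation E := (edges I).
Local Notation z := (@impedance R I).
Local Notation s := (@demand R I).

Definition Pe (e : {set node I}) : {set {set node I}} :=
  edge_path E (root I) e.

Definition Pk (k : customer I) : {set {set node I}} :=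
  node_path E (root I) (location k).

Definition decision := {ffun customer I -> bool}.

Definition constraintC : pred decision := fun x =>
  [forall e in E,
     cmod (\sum_(k | e \in Pk k) s k * (x k)%:R) <= capacity e].

Definition constraintV : pred decision := fun x =>
  [forall e in E,
     \sum_k (\sum_(e' in Pk k :&: Pe e)
               (complex.Re (z e') * complex.Re (s k)
                + complex.Im (z e') * complex.Im (s k))) * (x k)%:R
     <= Vbar I].

Definition constraintCV : pred decision :=
  fun x => constraintC x && constraintV x.

Definition total_utility (x : decision) : R :=
  \sum_k utility k * (x k)%:R.

Definition optimal (feas : pred decision) (x : decision) : Prop :=
  feas x /\ forall y, feas y -> total_utility y <= total_utility x.

(* On an instance without feasible points (possible when Vbar < 0) there is no
   optimum, and nothing is asked of the output. *)
Definition approximation (alpha : R) (feas : pred decision) (x : decision) :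
  Prop :=
  forall opt, optimal feas opt ->
    feas x /\ alpha * total_utility opt <= total_utility x.

Definition indicator (M : {set customer I}) : decision := [ffun k => k \in M].

(* Ties may be broken arbitrarily. *)
Definition greedy_order (o : seq (customer I)) : Prop :=
  perm_eq o (enum (customer I)) /\
  sorted (fun k k' => cmod (s k) <= cmod (s k')) o.

Definition greedy (feas : pred decision) (o : seq (customer I)) :
  {set customer I} :=
  foldl (fun M k => if feas (indicator (k |: M)) then k |: M else M) set0 o.

Definition GreedyAllocC o : decision := indicator (greedy constraintC o).
Definition GreedyAllocV o : decision := indicator (greedy constraintV o).
Definition GreedyAlloc o : decision := indicator (greedy constraintCV o).

(* All quantities maximized below are nonnegative, so the default value 0 only
   matters for an empty index range. *)
Definition theta : R :=
  \big[Num.max/0]_(k : customer I) \big[Num.max/0]_(k' : customer I)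
    `|carg (s k) - carg (s k')|.

Definition theta_zs : R :=
  \big[Num.max/0]_(k : customer I) \big[Num.max/0]_(e in Pk k)
    `|carg (s k) - carg (z e)|.

Definition eta : nat := \max_(e in E) #|Pe e|.

Definition rho : R :=
  \big[Num.max/0]_(e0 in E) \big[Num.max/0]_(e in Pe e0)
    \big[Num.max/0]_(e' in Pe e0) (cmod (z e) / cmod (z e')).

End Problem.

(* Main.v *)
Require Import Defs.
From mathcomp Require Import all_boot all_order all_algebra.
From mathcomp Require Import complex.
From mathcomp Require Import boolp reals trigo.
From mathcomp Require Import ring lra.

(** An exchange argument. Run the greedy algorithm next to an optimal solution
    [O], keeping the current greedy set [M] inside the feasible set [O]. When
    the algorithm accepts [k] outside [O], add [k] to [O] and delete an
    inclusion-minimal [J] inside [O \ M] that restores feasibility; all members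
    of [J] have demand at least [|s_k|]. If [J] always has at most [n] elements,
    then [O] ends up equal to the greedy output [M], and [|OPT| <= n |M|].

    For (C), let [e] be the violated edge closest to the root over all ways of
    putting one [j] back. Every member of [J] crosses [e], and at least
    [sec theta] vectors no shorter than [s_k] in a cone of angle [theta]
    outweigh [s_k], so [|J| - 1 < sec theta].

    For (V), everything in [J] shares with [k] the edge [f] at the root. At a
    violated edge [e] the drop caused by [k] is at most
    [eta rho |z_f| |s_k|], while each [j] in [J] causes at least
    [|z_f| |s_k| cos theta_zs], so [|J| - 1 < eta rho sec theta_zs].

    For both constraints together, delete the union of the two sets [J]. *)

Set Implicit Arguments.
Unset Strict Implicit.
Unset Printing Implicit Defensive.

Import Order.TTheory GRing.Theory Num.Theory.
Local Open Scope ring_scope.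

(** * Greedy runs compared with a feasible set under a hereditary constraint *)

Section GreedyExchange.
Variables (T : finType) (feas : pred {set T}) (le : rel T) (r : nat).
Hypothesis feasS : forall A B : {set T}, A \subset B -> feas B -> feas A.

(** The order hypothesis is what a run provides: members of [O :\: M] are still to be examined when
    [k] is. Deletions avoid [M], so greedy choices are never undone. *)
Definition exchangeable (c : nat) : Prop :=
  forall (M O : {set T}) (k : T),
    M \subset O -> feas O -> k \notin O -> feas (k |: M) ->
    {in O :\: M, forall j, le k j} ->
  exists J : {set T}, [/\ J \subset O :\: M, (#|J| <= c)%N & feas ((k |: O) :\: J)].

Let step (M : {set T}) (k : T) := if feas (k |: M) then k |: M else M.

Lemma greedy_fold_feasible (o : seq T) (M : {set T}) :
  feas M -> feas (foldl step M o).
Proof. by elim: o M => //= k o IH M fM; apply: IH; rewrite /step; case: ifP. Qed.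

(** Deleting all of [O :\: M] leaves only [k |: M], so a minimal feasible deletion exists below it.
    Minimality later supplies, for each [j] in [J], a constraint that breaks when [j] alone is put
    back. *)
Lemma minimal_removal (M O : {set T}) (k : T) :
  M \subset O -> k \notin O -> feas (k |: M) ->
  exists J : {set T}, [/\ J \subset O :\: M, feas ((k |: O) :\: J) &
    {in J, forall j, ~~ feas ((k |: O) :\: (J :\ j))}].
Proof.
move=> sMO kO fkM; pose P J := feas ((k |: O) :\: J).
have POM : P (O :\: M).
  apply: feasS fkM; apply/subsetP => x; rewrite !inE.
  by case: (x \in O) (x \in M) => [] []; rewrite ?orbT ?orbF.
have [J /minsetP[PJ Jmin] sJ] := minset_exists POM.
exists J; split=> // j jJ; apply/negP => /(Jmin (J :\ j)) /(_ (subsetDl _ _)) JE.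
by move: jJ; rewrite -JE !inE eqxx.
Qed.

Hypothesis exch : exchangeable r.+1.

(* The solution [O] stays feasible and absorbs the greedy choices one by one,
   each at the price of at most [r + 1] deletions, until it is the greedy output. *)
Lemma greedy_fold_card (o : seq T) (M O : {set T}) :
  M \subset O -> feas O -> pairwise le o -> {subset O :\: M <= o} ->
  (#|O| + r * #|M| <= r.+1 * #|foldl step M o|)%N.
Proof.
elim: o M O => [|k o IH] M O sMO fO /= po sub.
  (* Once no customer is left to examine, [O] equals [M] and the bound is an equality. *)
  have /eqP O_M : O :\: M == set0.
    by rewrite -subset0; apply/subsetP => x /sub.
  have -> : O = M by apply/eqP; rewrite eqEsubset sMO andbT -setD_eq0 O_M.
  by rewrite mulSn.
case/andP: po => /allP kle po.
rewrite /step; case: ifP => fk.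
  have [kO|kO] := boolP (k \in O).
    apply: leq_trans (IH (k |: M) O _ fO po _).
    - by rewrite leq_add2l leq_mul2l subset_leq_card ?orbT ?subsetUr.
    - by rewrite subUset sub1set kO.
    - move=> x; rewrite !inE negb_or => /andP[/andP[nxk xM] xO].
      by have := sub x; rewrite !inE xM xO (negbTE nxk) => /(_ isT).
  have kle' : {in O :\: M, forall j, le k j}.
    move=> j jOM; have := sub _ jOM; rewrite inE => /predU1P[jk|/kle//].
    by move: jOM; rewrite jk inE (negbTE kO) andbF.
  have [J [sJ cJ fJ]] := exch sMO fO kO fk kle'.
  have kJ : k \notin J.
    by apply/negP => /(subsetP sJ); rewrite inE (negbTE kO) andbF.
  (* Gaining [k] and losing at most [r + 1] elements costs [O] at most [r], which the growth of [M]
     by one offsets in the term [r * #|M|]. *)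
  have cO' : (#|O| <= #|(k |: O) :\: J| + r)%N.
    have : (#|k |: O| <= #|(k |: O) :\: J| + #|J|)%N.
      by rewrite -(cardsID J (k |: O)) addnC leq_add2l subset_leq_card // subsetIr.
    rewrite cardsU1 kO add1n => h; rewrite -ltnS (leq_trans h) //.
    by rewrite -addnS leq_add2l.
  have kM : k \notin M by apply: contra kO; apply: (subsetP sMO).
  apply: leq_trans (IH (k |: M) ((k |: O) :\: J) _ fJ po _).
  - by rewrite cardsU1 kM add1n mulnS addnA leq_add2r.
  - apply/subsetP => x xkM; rewrite inE (subsetP (setUS _ sMO)) // andbT.
    case/setU1P: xkM => [->//|xM].
    by apply/negP => /(subsetP sJ); rewrite inE xM.
  - move=> x; rewrite !inE negb_or => /andP[/andP[nxk xM]] /andP[_].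
    rewrite (negbTE nxk) /= => xO.
    by have := sub x; rewrite !inE xM xO (negbTE nxk) => /(_ isT).
(* A rejected [k] cannot lie in [O], since [k |: M] would then be a subset of the feasible [O]. *)
apply: IH => // x xOM; have := sub _ xOM; rewrite inE => /predU1P[xk|//].
move: xOM; rewrite xk inE => /andP[_ kO].
by move: fk; rewrite (@feasS _ O) // subUset sub1set kO.
Qed.

End GreedyExchange.

Lemma exchangeableI (T : finType) (feas1 feas2 : pred {set T}) (le : rel T) n1 n2 :
  (forall A B : {set T}, A \subset B -> feas1 B -> feas1 A) ->
  (forall A B : {set T}, A \subset B -> feas2 B -> feas2 A) ->
  exchangeable feas1 le n1 -> exchangeable feas2 le n2 ->
  exchangeable (fun A => feas1 A && feas2 A) le (n1 + n2).
Proof.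
move=> sub1 sub2 ex1 ex2 M O k sMO /andP[fO1 fO2] kO /andP[fk1 fk2] lek.
have [J1 [sJ1 cJ1 fJ1]] := ex1 _ _ _ sMO fO1 kO fk1 lek.
have [J2 [sJ2 cJ2 fJ2]] := ex2 _ _ _ sMO fO2 kO fk2 lek.
exists (J1 :|: J2); split; first by rewrite subUset sJ1.
  by rewrite (leq_trans _ (leq_add cJ1 cJ2)) // cardsU leq_subr.
by rewrite (sub1 _ _ _ fJ1) ?(sub2 _ _ _ fJ2) // setDS ?subsetUl ?subsetUr.
Qed.

(** * Paths to the root in an acyclic graph *)

Section Tree.
Variables (V : finType) (E : {set {set V}}) (r : V).
Hypothesis acyE : acyclic E.

Lemma adj_sym : symmetric (adj E).
Proof. by move=> v w; rewrite /adj setUC. Qed.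

Lemma simple_path_cons v w p :
  simple_path_to E r v (w :: p) -> simple_path_to E r w p.
Proof. by case=> /= /andP[_ ?] /andP[_ ?] ?; split. Qed.

Lemma last_notin_nil (v : V) p : uniq (v :: p) -> last v p = v -> p = [::].
Proof.
by case: p => // w p /= /andP[+ _] eqv; rewrite -eqv mem_last.
Qed.

(** If the paths part at [v], their two successors of [v] are joined through the root by a walk
    avoiding [v]. A simple path extracted from it closes up at [v] into a cycle of at least three
    vertices. *)
Lemma simple_path_unique v p q :
  simple_path_to E r v p -> simple_path_to E r v q -> p = q.
Proof.
elim: p v q => [|w p IH] v q Pp Pq.
  case: Pp => _ _ /= vr; case: Pq => _ uq lq.
  by rewrite (last_notin_nil uq) // lq vr.
case: q Pq => [|w' q] Pq.
  case: Pq => _ _ /= vr; case: Pp => _ up lp.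
  by rewrite (last_notin_nil up) // lp vr.
have [ww'|nww'] := eqVneq w w'.
  by subst w'; congr cons; apply: IH (simple_path_cons Pp) (simple_path_cons Pq).
case: Pp => /= /andP[avw pp] /andP[vp up] lp.
case: Pq => /= /andP[avw' pq] /andP[vq uq] lq.
(* Down [p] to the root and back along [q]; [belast] drops the root, which [p] has already
   reached. *)
have pc : path (adj E) w (p ++ rev (belast w' q)).
  rewrite cat_path pp lp -lq rev_path.
  by rewrite (eq_path (e' := adj E)) // => x y; rewrite /= adj_sym.
have lc : last w (p ++ rev (belast w' q)) = w'.
  rewrite last_cat; case: q lq {pq uq vq pc} => [|x q] /=; first by rewrite lp.
  by rewrite rev_cons last_rcons.
have vc : v \notin w :: (p ++ rev (belast w' q)).
  rewrite -cat_cons mem_cat negb_or vp mem_rev.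
  by apply: contra vq => /mem_belast.
case: (shortenP pc) lc => c pc' uc sc lc.
have /acyE : ucycle (adj E) (v :: w :: c).
  rewrite /ucycle /= avw rcons_path pc' lc adj_sym avw' /=.
  move: uc => /= -> /=; rewrite andbT.
  by apply: contra vc; rewrite !inE => /orP[->//|/sc ->]; rewrite orbT.
by case: c lc {pc' uc sc} => // /eqP; rewrite (negbTE nww').
Qed.

Lemma in_node_path v p f :
  simple_path_to E r v p -> (f \in node_path E r v) = (f \in edges_on v p).
Proof.
move=> Pp; rewrite inE; apply/asboolP/idP => [[q Pq]|]; last by exists p.
by rewrite (simple_path_unique Pq Pp).
Qed.

(** The definition of [edge_path] leaves the orientation of the edge open. The reverse orientation
    would make [p], the only path from [w], pass through [v], against simplicity of
    [v :: w :: p]. *)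
Lemma in_edge_path v w p f : simple_path_to E r v (w :: p) ->
  (f \in edge_path E r [set v; w]) = (f \in edges_on v (w :: p)).
Proof.
move=> Pp; rewrite inE; apply/asboolP/idP; last by exists v, w, p.
move=> [v' [w' [q [eqe Pq]]]].
have Pp' := simple_path_cons Pp; have Pq' := simple_path_cons Pq.
have [v'v|nv'v] := eqVneq v' v.
  by subst v'; rewrite (simple_path_unique Pq Pp).
have v'w : v' = w.
  have : v' \in [set v; w] by rewrite eqe !inE eqxx.
  by rewrite !inE (negbTE nv'v) => /eqP.
have vw' : v = w'.
  have : v \in [set v'; w'] by rewrite -eqe !inE eqxx.
  by rewrite !inE eq_sym (negbTE nv'v) => /eqP.
subst v' w'; have pE := simple_path_unique Pp' Pq; subst p.
by case: Pp => _ /=; rewrite !inE eqxx orbT.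
Qed.

Lemma edges_on_sub v p : path (adj E) v p -> {subset edges_on v p <= E}.
Proof.
elim: p v => //= w p IH v /andP[avw pp] f; rewrite inE => /predU1P[->//|].
exact: IH.
Qed.

Lemma edge_path_sub v p f : simple_path_to E r v p -> f \in edges_on v p ->
  {subset edge_path E r f <= edges_on v p}.
Proof.
elim: p v => // w p IH v Pp; rewrite [in X in X -> _]inE.
case/predU1P => [-> g|fp g gf]; first by rewrite (in_edge_path _ Pp).
by rewrite inE (IH w) ?orbT //; apply: simple_path_cons Pp.
Qed.

Lemma edges_on_comparable v p f g : simple_path_to E r v p ->
  f \in edges_on v p -> g \in edges_on v p ->
  (g \in edge_path E r f) || (f \in edge_path E r g).
Proof.
elim: p v => // w p IH v Pp fp gp.
move: (fp) (gp); rewrite inE => /predU1P[fE _|fp'].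
  by rewrite fE (in_edge_path _ Pp) gp.
rewrite inE => /predU1P[gE|gp']; first by rewrite gE (in_edge_path _ Pp) fp orbT.
exact: IH (simple_path_cons Pp) fp' gp'.
Qed.

Lemma edge_path_root_edge v p f : simple_path_to E r v p -> f \in edges_on v p ->
  exists2 g, g \in edge_path E r f & r \in g.
Proof.
elim: p v f => // w p IH v f Pp; rewrite inE => /predU1P[->|]; last first.
  exact: IH (simple_path_cons Pp).
case: p IH Pp => [_|x p IH] Pp.
  exists [set v; w]; first by rewrite (in_edge_path _ Pp) mem_head.
  by case: Pp => _ _ /= ->; rewrite !inE eqxx orbT.
have [g gP rg] := IH w _ (simple_path_cons Pp) (mem_head _ _).
exists g => //; rewrite (in_edge_path _ Pp) inE.
by rewrite -(in_edge_path _ (simple_path_cons Pp)) gP orbT.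
Qed.

(** A simple path meets its endpoint [r] only once, so only its last edge contains [r]. *)
Lemma root_edge_unique v p f g : simple_path_to E r v p ->
  f \in edges_on v p -> g \in edges_on v p -> r \in f -> r \in g -> f = g.
Proof.
elim: p v => // w p IH v Pp; have rvw : r \in [set v; w] -> p = [::].
  case: Pp => _ /= /andP[vp up] lp; rewrite !inE => /orP[] /eqP rE.
    by move: vp; rewrite -rE -lp mem_last.
  by apply: last_notin_nil up _; rewrite lp.
rewrite [in X in X -> _]inE [in X in _ -> X -> _]inE.
case/predU1P => [->|fp] /predU1P[->|gp] // rf rg.
- by move: gp; rewrite (rvw rf).
- by move: fp; rewrite (rvw rg).
exact: IH (simple_path_cons Pp) fp gp rf rg.
Qed.

Lemma node_pathP v f : f \in node_path E r v ->
  exists2 p, simple_path_to E r v p & f \in edges_on v p.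
Proof. by rewrite inE => /asboolP. Qed.

Lemma edge_pathP e f : f \in edge_path E r e -> exists v w p,
  [/\ e = [set v; w], simple_path_to E r v (w :: p) & f \in edges_on v (w :: p)].
Proof. by rewrite inE => /asboolP. Qed.

Lemma node_path_subE v : {subset node_path E r v <= E}.
Proof. by move=> f /node_pathP[p [pp _ _]]; apply: edges_on_sub. Qed.

Lemma edge_path_subE e : {subset edge_path E r e <= E}.
Proof. by move=> f /edge_pathP[v [w [p [_ [pp _ _]]]]]; apply: edges_on_sub. Qed.

Lemma node_path_closed v f :
  f \in node_path E r v -> {subset edge_path E r f <= node_path E r v}.
Proof.
move=> /node_pathP[p Pp fp] g gf.
by rewrite (in_node_path _ Pp) (edge_path_sub Pp fp).
Qed.

Lemma edge_path_closed e f :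
  f \in edge_path E r e -> {subset edge_path E r f <= edge_path E r e}.
Proof.
move=> /edge_pathP[v [w [p [-> Pp fp]]]] g gf.
by rewrite (in_edge_path _ Pp) (edge_path_sub Pp fp).
Qed.

Lemma node_path_comparable v f g : f \in node_path E r v -> g \in node_path E r v ->
  (g \in edge_path E r f) || (f \in edge_path E r g).
Proof.
move=> /node_pathP[p Pp fp]; rewrite (in_node_path _ Pp).
exact: edges_on_comparable Pp fp.
Qed.

Lemma node_path_root_edge v f : f \in node_path E r v ->
  exists2 g, g \in edge_path E r f & r \in g.
Proof. by move=> /node_pathP[p Pp]; apply: edge_path_root_edge Pp. Qed.

Lemma node_path_root_edge_unique v f g :
  f \in node_path E r v -> g \in node_path E r v -> r \in f -> r \in g -> f = g.
Proof.
move=> /node_pathP[p Pp fp]; rewrite (in_node_path _ Pp) => gp.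
exact: root_edge_unique Pp fp gp.
Qed.

Lemma edge_path_root_edge_unique e f g :
  f \in edge_path E r e -> g \in edge_path E r e -> r \in f -> r \in g -> f = g.
Proof.
move=> /edge_pathP[v [w [p [-> Pp fp]]]]; rewrite (in_edge_path _ Pp) => gp.
exact: root_edge_unique Pp fp gp.
Qed.

End Tree.

(** * Inner product, modulus and argument in the plane *)

Section PlaneVectors.
Variable R : realType.
Implicit Types z w : R[i].

(** The Euclidean inner product of the plane; the terms of the voltage constraint have this form. *)
Definition dot z w : R :=
  complex.Re z * complex.Re w + complex.Im z * complex.Im w.

Lemma dotDl z1 z2 w : dot (z1 + z2) w = dot z1 w + dot z2 w.
Proof. by case: z1 => ? ?; case: z2 => ? ?; rewrite /dot /=; ring. Qed.

Lemma dotC z w : dot z w = dot w z.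
Proof. by rewrite /dot; congr (_ + _); apply: mulrC. Qed.

Lemma dot0l w : dot 0 w = 0.
Proof. by rewrite /dot /= !mul0r addr0. Qed.

Lemma dot_suml (T : Type) (r : seq T) (P : pred T) (s : T -> R[i]) w :
  dot (\sum_(i <- r | P i) s i) w = \sum_(i <- r | P i) dot (s i) w.
Proof.
by apply: (big_morph (dot^~ w)) => [z1 z2|]; rewrite ?dotDl ?dot0l.
Qed.

Lemma cmod_ge0 z : 0 <= cmod z.
Proof. by case: z => x y; apply: sqrtr_ge0. Qed.

Lemma sqr_cmod z : cmod z ^+ 2 = dot z z.
Proof. by case: z => x y; rewrite sqr_sqrtr ?addr_ge0 ?sqr_ge0. Qed.

Lemma cmod_eq0 z : (cmod z == 0) = (z == 0).
Proof.
apply/eqP/eqP => [z0|->]; last by rewrite /cmod /= expr0n /= addr0 sqrtr0.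
have := sqr_cmod z; case: z z0 => x y ->; rewrite expr0n /dot /= -!expr2.
move/esym/eqP; rewrite paddr_eq0 ?sqr_ge0 // !sqrf_eq0.
by case/andP => /eqP -> /eqP ->.
Qed.

Lemma ler_cmod z w : (cmod z <= cmod w) = (dot z z <= dot w w).
Proof. by rewrite -!sqr_cmod ler_sqr ?nnegrE ?cmod_ge0. Qed.

Lemma cmodD_sqr z w : dot (z + w) (z + w) = dot z z + 2 * dot z w + dot w w.
Proof. by case: z => ? ?; case: w => ? ?; rewrite /dot /=; ring. Qed.

Lemma polar z : complex.Re z = cmod z * cos (carg z) /\
                complex.Im z = cmod z * sin (carg z).
Proof.
rewrite /carg; case: eqP => [->|/eqP z0].
  by rewrite /cmod /= expr0n /= addr0 sqrtr0 !mul0r.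
have m0 : cmod z != 0 by rewrite cmod_eq0.
have mp : 0 < cmod z by rewrite lt_def m0 cmod_ge0.
have sq : complex.Re z ^+ 2 + complex.Im z ^+ 2 = cmod z ^+ 2.
  by rewrite sqr_cmod.
have b : -1 <= complex.Re z / cmod z <= 1.
  rewrite -ler_norml -(@ler_pXn2r _ 2) ?nnegrE // expr1n real_normK ?num_real //.
  by rewrite expr_div_n ler_pdivrMr ?exprn_gt0 // mul1r -sq lerDl sqr_ge0.
have sinE : cmod z * sin (acos (complex.Re z / cmod z)) = `|complex.Im z|.
  rewrite sin_acos // -[X in X * _]gtr0_norm // -sqrtr_sqr -sqrtrM ?sqr_ge0 //.
  by rewrite mulrBr mulr1 -exprMn mulrCA divff // mulr1 -sq addrAC subrr add0r sqrtr_sqr.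
have cosE : cmod z * cos (acos (complex.Re z / cmod z)) = complex.Re z.
  by rewrite acosK // mulrCA divff // mulr1.
case: leP => im; rewrite ?cosN ?sinN ?mulrN cosE sinE; split=> //.
  by rewrite ger0_norm.
by rewrite ltr0_norm ?opprK.
Qed.

Lemma dot_polar z w : dot z w = cmod z * cmod w * cos (carg z - carg w).
Proof.
have [zr zi] := polar z; have [wr wi] := polar w.
by rewrite /dot zr zi wr wi cosB; ring.
Qed.

Lemma le_cos_of_norm (x t : R) : `|x| <= t -> t <= pi -> cos t <= cos x.
Proof.
move=> xt tpi; rewrite -[cos x]cos_norm; case: leP => // lt.
have t0 : 0 <= t := le_trans (normr_ge0 x) xt.
move: lt; rewrite ltr_cos ?in_itv /= ?normr_ge0 ?t0 ?tpi ?(le_trans xt) //.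
by rewrite ltNge xt.
Qed.

Lemma dot_ge_of_carg z w (t : R) : `|carg z - carg w| <= t -> t <= pi ->
  cos t * (cmod z * cmod w) <= dot z w.
Proof.
move=> zw tpi; rewrite dot_polar mulrC ler_wpM2l ?mulr_ge0 ?cmod_ge0 //.
exact: le_cos_of_norm.
Qed.

Lemma dot_le_cmod z w : dot z w <= cmod z * cmod w.
Proof.
rewrite dot_polar -[leRHS]mulr1 ler_wpM2l ?mulr_ge0 ?cmod_ge0 //.
exact: cos_le1.
Qed.

End PlaneVectors.

(** * Sums of vectors in a narrow cone *)

Section NarrowCone.
Variables (R : realType) (T : finType) (s : T -> R[i]) (c : R).
Hypothesis c_ge0 : 0 <= c.
Hypothesis s_cone : forall i j, c * (cmod (s i) * cmod (s j)) <= dot (s i) (s j).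

Lemma cone_dot_ge0 i j : 0 <= dot (s i) (s j).
Proof. by apply: le_trans (s_cone i j); rewrite !mulr_ge0 ?cmod_ge0. Qed.

Lemma cone_dot_sum_ge0 (P Q : pred T) :
  0 <= dot (\sum_(i | P i) s i) (\sum_(i | Q i) s i).
Proof.
rewrite dot_suml sumr_ge0 // => i _; rewrite dotC dot_suml sumr_ge0 // => j _.
exact: cone_dot_ge0.
Qed.

(** Inner products inside the cone are nonnegative, so the cross term of the squared modulus is too,
    and extra vectors never shorten a sum. *)
Lemma cone_cmod_sum_le (P Q : pred T) : (forall i, P i -> Q i) ->
  cmod (\sum_(i | P i) s i) <= cmod (\sum_(i | Q i) s i).
Proof.
move=> PQ; rewrite ler_cmod [in leRHS](bigID P) /= (eq_bigl P); last first.
  by move=> i; case: (boolP (P i)) => [/PQ ->|]; rewrite ?andbF.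
rewrite cmodD_sqr -addrA lerDl addr_ge0 ?mulr_ge0 //.
  exact: cone_dot_sum_ge0.
exact: (cone_dot_sum_ge0 [pred i | Q i && ~~ P i] [pred i | Q i && ~~ P i]).
Qed.

(** The expanded squares compare term by term. For the cross terms, each [j] in [J] contributes at
    least the fraction [c] of the largest possible contribution of [k]. For the pure squares, a
    single member of [J] already suffices. *)
Lemma cone_cmod_swap (P : pred T) (J : {set T}) (k : T) :
  c <= 1 -> {in J, forall j, cmod (s k) <= cmod (s j)} -> 1 <= #|J|%:R * c ->
  cmod (s k + \sum_(i | P i) s i) <=
  cmod (\sum_(j in J) s j + \sum_(i | P i) s i).
Proof.
move=> c1 leJ cJ; rewrite ler_cmod !cmodD_sqr.
have BS : dot (s k) (\sum_(i | P i) s i) <=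
          dot (\sum_(j in J) s j) (\sum_(i | P i) s i).
  rewrite ![dot _ (\sum_(i | P i) s i)]dotC !dot_suml; apply: ler_sum => i _.
  apply: le_trans (dot_le_cmod _ _) _.
  rewrite dotC dot_suml.
  apply: le_trans (_ : \sum_(j in J) c * (cmod (s k) * cmod (s i)) <= _).
    rewrite sumr_const -mulr_natl mulrA [X in X <= _]mulrC -[X in X <= _]mul1r.
    by rewrite ler_wpM2r ?mulr_ge0 ?cmod_ge0.
  apply: ler_sum => j jJ; apply: le_trans (s_cone j i).
  by rewrite ler_wpM2l // ler_wpM2r ?cmod_ge0 ?leJ.
have SS : dot (s k) (s k) <= dot (\sum_(j in J) s j) (\sum_(j in J) s j).
  have [j jJ] : exists j, j \in J.
    apply/set0Pn; apply/eqP => J0; move: cJ.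
    by rewrite J0 cards0 mul0r lt_geF ?ltr01.
  rewrite -ler_cmod (le_trans (leJ j jJ)) //.
  have := @cone_cmod_sum_le (pred1 j) (mem J) _.
  by rewrite big_pred1_eq; apply => i /eqP ->.
by rewrite lerD2r lerD // ler_wpM2l.
Qed.

End NarrowCone.

(** * The constraints as predicates on sets of customers *)

Section Instance.
Variables (R : realType) (I : opf_instance R).
Local Notation E := (edges I).
Local Notation z := (@impedance R I).
Local Notation s := (@demand R I).

Let acyI : acyclic E. Proof. by case: (treeP I). Qed.

Definition no_larger : rel (customer I) := fun k k' => cmod (s k) <= cmod (s k').

Lemma Pk_sub_edges k : {subset Pk k <= E}.
Proof. exact: node_path_subE. Qed.

Definition load (A : {set customer I}) (e : {set node I}) : R :=
  cmod (\sum_(k | (e \in Pk k) && (k \in A)) s k).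

Lemma constraintC_indicator (A : {set customer I}) :
  constraintC (indicator A) = [forall e in E, load A e <= capacity e].
Proof.
apply: eq_forallb_in => e _; congr (cmod _ <= _); rewrite [RHS]big_mkcondr.
by apply: eq_bigr => k _; rewrite ffunE; case: ifP; rewrite ?mulr1 ?mulr0.
Qed.

Definition voltage_drop (k : customer I) (e : {set node I}) : R :=
  \sum_(f in Pk k :&: Pe e) dot (z f) (s k).

Lemma constraintV_indicator (A : {set customer I}) :
  constraintV (indicator A) = [forall e in E, \sum_(k in A) voltage_drop k e <= Vbar I].
Proof.
apply: eq_forallb_in => e _; congr (_ <= _); rewrite [RHS]big_mkcond.
by apply: eq_bigr => k _; rewrite ffunE; case: ifP; rewrite ?mulr1 ?mulr0.
Qed.

(** * The exchange property for the capacity constraint *)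

Section Capacity.
Hypothesis theta_lt : theta I < pi / 2.
Hypothesis theta_ge0 : 0 <= theta I.

Lemma cos_theta_gt0 : 0 < cos (theta I).
Proof.
apply: cos_gt0_pihalf; rewrite theta_lt andbT (lt_le_trans _ theta_ge0) //.
by rewrite oppr_lt0 divr_gt0 ?pi_gt0.
Qed.

Lemma demand_cone (k j : customer I) :
  cos (theta I) * (cmod (s k) * cmod (s j)) <= dot (s k) (s j).
Proof.
apply: dot_ge_of_carg.
  by apply: (bigmax_sup k) => //; apply: (bigmax_sup j).
rewrite (le_trans (ltW theta_lt)) // ler_pdivrMr // ler_peMr ?pi_ge0 //.
by rewrite ler1n.
Qed.

(** Inclusion is asked only of customers crossing [e], so that a customer elsewhere may be added or
    removed freely. *)
Lemma load_sub e (A B : {set customer I}) :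
  (forall k, e \in Pk k -> k \in A -> k \in B) -> load A e <= load B e.
Proof.
move=> AB; rewrite /load.
apply: (cone_cmod_sum_le (ltW cos_theta_gt0) demand_cone) => k.
by case/andP=> ek /(AB _ ek) ->; rewrite ek.
Qed.

Lemma constraintC_sub (A B : {set customer I}) : A \subset B ->
  constraintC (indicator B) -> constraintC (indicator A).
Proof.
move=> /subsetP sAB; rewrite !constraintC_indicator => /forall_inP fB.
apply/forall_inP => e eE; apply: le_trans (fB e eE); apply: load_sub => k _.
exact: sAB.
Qed.

Lemma exchangeableC (n : nat) : sec (theta I) <= n%:R ->
  exchangeable (fun A => constraintC (indicator A)) no_larger n.
Proof.
move=> sec_n M O k sMO fO kO fkM klarge.
have [J [sJ fJ Jmin]] := minimal_removal constraintC_sub sMO kO fkM.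
exists J; split=> //; move: fO fJ; rewrite !constraintC_indicator.
move=> /forall_inP fO /forall_inP fJ.
have [->|[j1 j1J]] := set_0Vmem J; first by rewrite cards0.
(* A pair [(j, e)] is recorded when putting back [j] alone overloads [e]. Such an edge is crossed by
   [k], since [O] is feasible, and by [j], since [(k |: O) :\: J] is. *)
pose viol (je : customer I * {set node I}) :=
  [&& je.1 \in J, je.2 \in E & capacity je.2 < load ((k |: O) :\: (J :\ je.1)) je.2].
have ex_viol j : j \in J -> exists e, viol (j, e).
  move=> jJ; have := Jmin j jJ; rewrite constraintC_indicator => /forall_inPn[e eE].
  by rewrite -ltNge => ve; exists e; rewrite /viol /= jJ eE.
have viol_k j e : viol (j, e) -> e \in Pk k.
  case/and3P => /= jJ eE; apply: contraTT => ek; rewrite -leNgt.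
  apply: le_trans (fO e eE).
  apply: load_sub => i ei; rewrite !inE => /andP[_ /predU1P[ik|//]].
  by rewrite ik (negbTE ek) in ei.
have viol_j j e : viol (j, e) -> e \in Pk j.
  case/and3P => /= jJ eE; apply: contraTT => ej; rewrite -leNgt.
  apply: le_trans (fJ e eE).
  apply: load_sub => i ei; rewrite !inE => /andP[+ ->]; rewrite andbT negb_and negbK.
  by case/predU1P => [ij|//]; rewrite ij (negbTE ej) in ei.
have [e1 v1] := ex_viol _ j1J.
(* A violated edge shared by the most customers is the one closest to the
   root, so all of [J] crosses it. *)
have [[j0 e0] v0 maxe] :=
  arg_maxnP (fun je : _ * _ => #|[set i : customer I | je.2 \in Pk i]|) v1.
have J_e0 j : j \in J -> e0 \in Pk j.
  move=> jJ; have [e ve] := ex_viol j jJ; have ej := viol_j _ _ ve.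
  (* Both edges lie on the path of [k]. If [e] is nearer the root, every customer crossing [e0]
     crosses [e], and maximality makes the two customer sets equal. *)
  have /orP[e_e0|e0_e] := node_path_comparable acyI (viol_k _ _ v0) (viol_k _ _ ve).
    have sub : [set i | e0 \in Pk i] \subset [set i | e \in Pk i].
      apply/subsetP => i; rewrite inE => e0i; rewrite inE.
      exact: (node_path_closed acyI e0i e_e0).
    have /eqP/setP/(_ j) : [set i | e0 \in Pk i] == [set i | e \in Pk i].
      by rewrite eqEcard sub; apply: (maxe (j, e)).
    by rewrite inE [X in _ = X]inE ej.
  exact: (node_path_closed acyI ej).
have k_e0 := viol_k _ _ v0; case/and3P: v0 => /= j0J e0E viol0.
have kJ : k \notin J by apply: contra kO => /(subsetP sJ); rewrite inE => /andP[].
pose P := [pred i | (e0 \in Pk i) && (i \in O :\: (J :\ j0))].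
have load_new : load ((k |: O) :\: (J :\ j0)) e0 = cmod (s k + \sum_(i | P i) s i).
  congr cmod; rewrite (bigD1 k) /=; last by rewrite k_e0 !inE eqxx (negbTE kJ) andbF.
  congr (_ + _); apply: eq_bigl => i; rewrite !inE.
  by have [->|_] := eqVneq i k; rewrite ?(negbTE kO) ?andbF ?andbT.
have load_old : load O e0 = cmod (\sum_(j in J :\ j0) s j + \sum_(i | P i) s i).
  congr cmod; rewrite (bigID (mem (J :\ j0))) /=; congr (_ + _); apply: eq_bigl => i.
    rewrite in_setD1; have [iJ|] := boolP (i \in J); last by rewrite !andbF.
    by rewrite J_e0 //; have /setDP[-> _] := subsetP sJ _ iJ.
  by rewrite /P /= [in RHS]in_setD -andbA [(i \in O) && _]andbC.
(* Otherwise replacing [J :\ j0] by [k] would not raise the load on [e0] above that of [O], which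
   respects the capacity. *)
have few : #|J :\ j0|%:R * cos (theta I) < 1.
  rewrite ltNge; apply/negP => many; move: viol0.
  rewrite load_new ltNge => /negP; apply.
  apply: le_trans (fO e0 e0E).
  rewrite -/(load O e0) load_old.
  apply: (cone_cmod_swap (ltW cos_theta_gt0) demand_cone _ (cos_le1 _) _ many).
  by move=> j /setD1P[_ /(subsetP sJ) /klarge].
rewrite (cardsD1 j0 J) j0J add1n -(ltr_nat R); apply: lt_le_trans sec_n.
by rewrite /sec -[ltRHS]mul1r ltr_pdivlMr ?cos_theta_gt0.
Qed.

End Capacity.

(** * The exchange property for the voltage constraint *)

Section Voltage.
Hypothesis theta_zs_lt : theta_zs I < pi / 2.
Hypothesis theta_zs_ge0 : 0 <= theta_zs I.

Lemma cos_theta_zs_gt0 : 0 < cos (theta_zs I).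
Proof.
apply: cos_gt0_pihalf; rewrite theta_zs_lt andbT (lt_le_trans _ theta_zs_ge0) //.
by rewrite oppr_lt0 divr_gt0 ?pi_gt0.
Qed.

Lemma dot_impedance_ge (k : customer I) f : f \in Pk k ->
  cos (theta_zs I) * (cmod (z f) * cmod (s k)) <= dot (z f) (s k).
Proof.
move=> fk; apply: dot_ge_of_carg.
  by rewrite distrC; apply: (bigmax_sup k) => //; apply: (bigmax_sup f).
rewrite (le_trans (ltW theta_zs_lt)) // ler_pdivrMr // ler_peMr ?pi_ge0 //.
by rewrite ler1n.
Qed.

Lemma dot_impedance_ge0 (k : customer I) f : f \in Pk k -> 0 <= dot (z f) (s k).
Proof.
move/dot_impedance_ge; apply: le_trans.
by rewrite !mulr_ge0 ?cmod_ge0 ?(ltW cos_theta_zs_gt0).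
Qed.

Lemma voltage_drop_ge0 k e : 0 <= voltage_drop k e.
Proof. by apply: sumr_ge0 => f /setIP[fk _]; apply: dot_impedance_ge0. Qed.

Lemma constraintV_sub (A B : {set customer I}) : A \subset B ->
  constraintV (indicator B) -> constraintV (indicator A).
Proof.
move=> sAB; rewrite !constraintV_indicator => /forall_inP fB.
apply/forall_inP => e eE.
apply: le_trans (fB e eE); rewrite [leRHS](big_setID A) /= (setIidPr sAB).
by rewrite lerDl sumr_ge0 // => k _; apply: voltage_drop_ge0.
Qed.

Lemma voltage_drop_ge k e f : f \in Pk k -> f \in Pe e ->
  cmod (z f) * cos (theta_zs I) * cmod (s k) <= voltage_drop k e.
Proof.
move=> fk fe; rewrite [cmod _ * cos _]mulrC -mulrA.
apply: le_trans (dot_impedance_ge fk) _.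
have fke : f \in Pk k :&: Pe e by apply/setIP.
rewrite /voltage_drop (bigD1 f fke) /= lerDl sumr_ge0 // => g.
by case/andP => /setIP[gk _] _; apply: dot_impedance_ge0.
Qed.

Lemma cmod_impedance_gt0 e : e \in E -> 0 < cmod (z e).
Proof.
move=> eE; rewrite lt_def cmod_ge0 cmod_eq0 andbT.
by apply/eqP => z0; have := impedance_Re_gt0 eE; rewrite z0 ltxx.
Qed.

(** The sum runs over at most [eta] edges, all on the same path as [f], so [rho] bounds each
    impedance ratio. *)
Lemma voltage_drop_le k e f : e \in E -> f \in Pe e ->
  voltage_drop k e <= (eta I)%:R * rho I * cmod (z f) * cmod (s k).
Proof.
move=> eE fe; have zf : 0 < cmod (z f).
  by apply/cmod_impedance_gt0/(edge_path_subE fe).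
have rho_ge g : g \in Pe e -> cmod (z g) / cmod (z f) <= rho I.
  move=> ge; apply: (bigmax_sup e) => //; apply: (bigmax_sup g) => //.
  exact: (bigmax_sup f).
have rho0 : 0 <= rho I by apply: le_trans (rho_ge f fe); rewrite divr_ge0 ?cmod_ge0.
apply: le_trans (_ : \sum_(g in Pk k :&: Pe e) rho I * cmod (z f) * cmod (s k) <= _).
  apply: ler_sum => g /setIP[_ ge]; apply: le_trans (dot_le_cmod _ _) _.
  by rewrite ler_wpM2r ?cmod_ge0 // -ler_pdivrMr ?rho_ge.
rewrite sumr_const -[leLHS]mulr_natl -!mulrA ler_wpM2r ?mulr_ge0 ?cmod_ge0 //.
rewrite ler_nat (leq_trans (subset_leq_card (subsetIr _ _))) //.
exact: (bigop.bigmax_sup e).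
Qed.

(** A nonzero drop needs an edge common to both paths; from there on the paths agree down to the
    root edge. *)
Lemma voltage_drop_neq0_root_edge k e : voltage_drop k e != 0 ->
  exists f, [/\ f \in Pk k, f \in Pe e & Defs.root I \in f].
Proof.
move=> d0; have [/eqP|[g /setIP[gk ge]]] := set_0Vmem (Pk k :&: Pe e).
  by move/eqP=> PkPe; move: d0; rewrite /voltage_drop PkPe big_set0 eqxx.
have [f fg rf] := node_path_root_edge acyI gk.
exists f; split=> //; first exact: (node_path_closed acyI gk).
exact: (edge_path_closed acyI ge).
Qed.

Lemma exchangeableV (n : nat) :
  (eta I)%:R * rho I * sec (theta_zs I) <= n%:R ->
  exchangeable (fun A => constraintV (indicator A)) no_larger n.
Proof.
move=> sec_n M O k sMO fO kO fkM klarge.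
have [J [sJ fJ Jmin]] := minimal_removal constraintV_sub sMO kO fkM.
exists J; split=> //; move: fO fJ; rewrite !constraintV_indicator.
move=> /forall_inP fO /forall_inP fJ.
have [->|[j0 j0J]] := set_0Vmem J; first by rewrite cards0.
have kJ : k \notin J by apply: contra kO => /(subsetP sJ); rewrite inE => /andP[].
have sJO : J \subset O by apply: subset_trans sJ (subsetDl _ _).
have viol j : j \in J -> exists2 e, e \in E &
    Vbar I < \sum_(i in (k |: O) :\: (J :\ j)) voltage_drop i e.
  move=> jJ; have := Jmin j jJ; rewrite constraintV_indicator => /forall_inPn[e eE].
  by rewrite -ltNge; exists e.
(* At an edge violated after putting back [j], comparison with the feasible [O] shows that [k]
   outweighs all the customers still deleted. *)
have swap j e : j \in J -> e \in E ->
    Vbar I < \sum_(i in (k |: O) :\: (J :\ j)) voltage_drop i e ->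
  \sum_(i in J :\ j) voltage_drop i e < voltage_drop k e.
  move=> jJ eE; have sJj := subset_trans (subsetDl J [set j]) sJO.
  have -> : (k |: O) :\: (J :\ j) = k |: (O :\: (J :\ j)).
    apply/setP => i; rewrite !inE; have [->|//] := eqVneq i k.
    by rewrite (negbTE kJ) andbF.
  rewrite big_setU1 /=; last by rewrite !inE negb_and kO orbT.
  move=> /(le_lt_trans (fO e eE)).
  by rewrite (big_setID (J :\ j)) /= (setIidPr sJj) ltrD2r.
(* The drop of [k] at [e] is positive by [swap]. That of [j] is nonzero, as putting [j] back would
   otherwise violate nothing there. *)
have root_edge j e : j \in J -> e \in E ->
    Vbar I < \sum_(i in (k |: O) :\: (J :\ j)) voltage_drop i e ->
  exists f, [/\ f \in Pk k, f \in Pk j, f \in Pe e & Defs.root I \in f].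
  move=> jJ eE ve.
  have [|f [fk fe rf]] := @voltage_drop_neq0_root_edge k e.
    by rewrite gt_eqF // (le_lt_trans _ (swap j e jJ eE ve)) ?sumr_ge0 // => i _; apply: voltage_drop_ge0.
  have [|f' [f'j f'e rf']] := @voltage_drop_neq0_root_edge j e.
    apply: contraTneq ve => d0; rewrite -leNgt.
    apply: le_trans (fJ e eE).
    have -> : (k |: O) :\: (J :\ j) = j |: ((k |: O) :\: J).
      apply/setP => i; rewrite !inE; have [->|//] := eqVneq i j.
      by rewrite (subsetP sJO) ?orbT.
    by rewrite big_setU1 /= ?d0 ?add0r // !inE jJ.
  exists f; split=> //.
  by rewrite (edge_path_root_edge_unique acyI fe f'e rf rf').
have [e eE ve] := viol j0 j0J.
have [f [fk _ fe rf]] := root_edge j0 e j0J eE ve.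
(* The violated edge varies with [j], but the root edge it yields is always that of the path of
   [k]. *)
have fJ' j : j \in J -> f \in Pk j.
  move=> jJ; have [e' e'E ve'] := viol j jJ.
  have [f' [f'k f'j _ rf']] := root_edge j e' jJ e'E ve'.
  by rewrite (node_path_root_edge_unique acyI fk f'k rf rf').
have zf : 0 < cmod (z f) by apply/cmod_impedance_gt0/(Pk_sub_edges fk).
(* Each member of [J] causes at [e] a drop of at least [t], through the edge [f] alone. *)
set t := cmod (z f) * cos (theta_zs I) * cmod (s k).
have t_ge0 : 0 <= t by rewrite !mulr_ge0 ?cmod_ge0 ?(ltW cos_theta_zs_gt0).
have lt_t : #|J :\ j0|%:R * t < (eta I)%:R * rho I * sec (theta_zs I) * t.
  apply: (@le_lt_trans _ _ (\sum_(i in J :\ j0) voltage_drop i e)).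
    rewrite mulr_natl -sumr_const; apply: ler_sum => j /setD1P[_ jJ].
    apply: le_trans (voltage_drop_ge (fJ' j jJ) fe).
    rewrite ler_wpM2l ?mulr_ge0 ?cmod_ge0 ?(ltW cos_theta_zs_gt0) //.
    exact/klarge/(subsetP sJ).
  apply: lt_le_trans (swap j0 e j0J eE ve) _.
  apply: le_trans (voltage_drop_le k eE fe) _.
  rewrite le_eqVlt; apply/orP; left; apply/eqP; rewrite /t /sec.
  by field; rewrite gt_eqF ?cos_theta_zs_gt0.
rewrite (cardsD1 j0 J) j0J add1n -(ltr_nat R); apply: lt_le_trans sec_n.
(* The strict inequality [lt_t] excludes [t = 0], so [t] can be cancelled. *)
have t_gt0 : 0 < t.
  by rewrite lt_def t_ge0 andbT; apply: contraTneq lt_t => ->; rewrite !mulr0 ltxx.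
by rewrite -(ltr_pM2r t_gt0).
Qed.

End Voltage.

(** * From exchange properties to approximation ratios *)

Lemma greedy_approximation (feas : pred (decision I)) (o : seq (customer I)) n :
  (forall k : customer I, utility k = 1) -> greedy_order o ->
  (forall A B : {set customer I}, A \subset B ->
     feas (indicator B) -> feas (indicator A)) ->
  exchangeable (fun A => feas (indicator A)) no_larger n.+1 ->
  approximation n.+1%:R^-1 feas (indicator (greedy feas o)).
Proof.
move=> u1 [perm_o sort_o] feas_sub exch x [fx _].
have xE : x = indicator [set k | x k] by apply/ffunP => k; rewrite ffunE inE.
have utilE (A : {set customer I}) : total_utility (indicator A) = #|A|%:R.
  rewrite /total_utility -sum1_card natr_sum [RHS]big_mkcond.
  by apply: eq_bigr => k _; rewrite ffunE u1 mul1r; case: ifP.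
(* The optimum is feasible, hence so is the empty set from which the run starts. *)
rewrite xE in fx *; have f0 := feas_sub _ _ (sub0set _) fx.
split; first
  exact: (greedy_fold_feasible (feas := fun A => feas (indicator A)) o f0).
rewrite !utilE ler_pdivrMl ?ltr0n // -natrM ler_nat.
apply: leq_trans (leq_addr (n * #|set0 : {set customer I}|) _) _.
apply: (greedy_fold_card feas_sub exch) => //; first exact: sub0set.
  rewrite -sorted_pairwise //.
  by move=> k1 k2 k3; apply: le_trans.
by move=> k _; rewrite (perm_mem perm_o) mem_enum.
Qed.

End Instance.

Lemma floor_succ_nat (R : realType) (x : R) : 0 <= x ->
  (Num.floor x + 1)%:~R = (`|Num.floor x|%N.+1)%:R :> R.
Proof.
by rewrite -floor_ge0 => x0; rewrite -addn1 natrD intrD -[in LHS](gez0_abs x0).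
Qed.

Lemma le_floor_succ_nat (R : realType) (x : R) : 0 <= x ->
  x <= (`|Num.floor x|%N.+1)%:R.
Proof. by move=> x0; rewrite -floor_succ_nat //; case/andP: (floor_itv x) => _ /ltW. Qed.

Theorem theorem3 (R : realType) (I : opf_instance R) (o : seq (customer I))
  (unit_utility : forall k : customer I, utility k = 1)
  (theta_bounds : 0 <= theta I < pi / 2)
  (theta_zs_bounds : 0 <= theta_zs I < pi / 2)
  (o_sorted : greedy_order o) :
  let a := Num.floor (sec (theta I) * sec (theta I / 2)) in
  let b := Num.floor ((eta I)%:R * rho I * sec (theta_zs I)) in
  [/\ approximation ((a + 1)%:~R^-1) (@constraintC R I) (GreedyAllocC o),
      approximation ((b + 1)%:~R^-1) (@constraintV R I) (GreedyAllocV o)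
    & approximation ((b + a + 2)%:~R^-1) (@constraintCV R I) (GreedyAlloc o)].
Proof.
move: theta_bounds theta_zs_bounds => /andP[t0 t1] /andP[zs0 zs1] a b.
have cos_t := cos_theta_gt0 t1 t0; have cos_zs := cos_theta_zs_gt0 zs1 zs0.
have pi0 := pi_gt0 R.
have cos_t2 : 0 < cos (theta I / 2) by apply: cos_gt0_pihalf; lra.
have sec_t2 : 1 <= sec (theta I / 2) by rewrite invf_ge1 ?cos_le1.
have sec_t : 0 <= sec (theta I) by rewrite invr_ge0 ltW.
have a_ge0 : 0 <= sec (theta I) * sec (theta I / 2).
  by rewrite mulr_ge0 // (le_trans ler01).
have rho0 : 0 <= rho I by apply: bigmax_ge_id.
have b_ge0 : 0 <= (eta I)%:R * rho I * sec (theta_zs I).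
  by rewrite !mulr_ge0 // invr_ge0 ltW.
have exC : exchangeable (fun A => constraintC (indicator A)) (@no_larger R I) `|a|%N.+1.
  (* The exchange bound [sec theta] is at most the stated product because [sec (theta / 2)] is at
     least 1. *)
  apply: (exchangeableC t1 t0); apply: le_trans (le_floor_succ_nat a_ge0).
  exact: ler_peMr.
have exV : exchangeable (fun A => constraintV (indicator A)) (@no_larger R I) `|b|%N.+1.
  exact/(exchangeableV zs1 zs0)/le_floor_succ_nat.
have subC := constraintC_sub t1 t0; have subV := constraintV_sub zs1 zs0.
split.
- by rewrite floor_succ_nat //; apply: greedy_approximation.
- by rewrite floor_succ_nat //; apply: greedy_approximation.
(* The two deletion bounds, floor plus one each, add up to the denominator of the combined ratio. *)
have -> : (b + a + 2)%:~R = (`|a|%N + `|b|%N.+1).+1%:R :> R.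
  by rewrite -addSn natrD -!floor_succ_nat // -intrD; congr (_%:~R); ring.
apply: greedy_approximation => //; last exact: (exchangeableI subC subV exC exV).
by move=> A B sAB /andP[fC fV]; rewrite /constraintCV (subC _ _ sAB) ?(subV _ _ sAB).
Qed.
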